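(* (i) If $\mathbb{E} Z<\infty$, then, with probability one, there exists a unique integer $i\le 0$ such that $S^{(i)}=\infty$, and the forest contains a unique maximal infinite path. Moreover, $$\mathbb{P}\{S^{(0)}=\infty\}=\frac{1}{\mathbb{E} Z}.$$ (ii) If $q_i>0$ for all $i\in\mathbb{N}$ and $\mathbb{E} Z=\infty$, then $$\mathbb{P}\{\exists\, i\le 0:\ S^{(i)}=\infty\}=0.$$
   Context: $\mathbb{N}=\{1,2,\ldots\}$. Let $Z,Z_1,Z_2,\ldots$ be independent, identically distributed random variables taking values in $\mathbb{N}$, and write $q_n=\mathbb{P}\{Z=n\}$ for $n\in\mathbb{N}$. The coloring $(C_n)_{n\in\mathbb{Z}}$ is defined by $C_i=i$ for all integers $i\le 0$ and $C_n=C_{n-Z_n}$ for $n\in\mathbb{N}$. The subtractive random forest has vertex set $\mathbb{Z}$; each $i\le 0$ is the root of a tree $T^{(i)}$ whose non-root vertices are the $n\in\mathbb{N}$ with $C_n=i$, and each $n\in\mathbb{N}$ is joined by an edge to its parent $n-Z_n$. For $i\le 0$, $S^{(i)}=\sum_{t\in\mathbb{N}}\mathbf{1}_{\{C_t=i\}}$ is the size of $T^{(i)}$ (excluding its root). A set of vertices $\{n_1,n_2,\ldots\}\subset\mathbb{N}$ with $n_1<n_2<\cdots$ (an infinite sequence) forms a maximal infinite path if $n_k-Z_{n_k}=n_{k-1}$ for all $k>1$ and $n_1-Z_{n_1}\le 0$.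
   Formalization: Part (i) additionally assumes gcd{n : q_n > 0} = 1; without it the claim fails (for Z = 2 almost surely there are two infinite trees and P{S^(0)=∞} = 1, not 1/2), and it fails for every law with gcd > 1. *)

(* Defs.v *)
From HB Require Import structures.
From mathcomp Require Import all_boot all_order all_algebra.
From mathcomp Require Import all_classical all_reals all_analysis.

Set Implicit Arguments.
Unset Strict Implicit.
Unset Printing Implicit Defensive.

Import Order.TTheory GRing.Theory Num.Theory.
Import numFieldNormedType.Exports.

Local Open Scope classical_set_scope.
Local Open Scope ring_scope.

Definition mutually_independent d d' (T : measurableType d)
    (T' : measurableType d') (R : realType) (P : probability T R)
    (I : choiceType) (X : I -> {RV P >-> T'}) : Prop :=
  forall (J : seq I) (A : I -> set T'), uniq J ->
    (forall i, measurable (A i)) ->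
    P (\bigcap_(i in [set` J]) (X i @^-1` A i)) =
    (\prod_(i <- J) P (X i @^-1` A i))%E.

Definition identically_distributed d d' (T : measurableType d)
    (T' : measurableType d') (R : realType) (P : probability T R)
    (I : Type) (X : I -> {RV P >-> T'}) : Prop :=
  forall (i j : I) (A : set T'), measurable A ->
    distribution P (X i) A = distribution P (X j) A.

(* The greatest common divisor of the support {n >= 1 | q n > 0} is 1. If it is
   m > 1, the forest splits into the residue classes modulo m, each with its own
   infinite tree when the mean is finite, so uniqueness of the infinite tree
   requires this condition. *)
Definition aperiodic (R : realType) (q : nat -> \bar R) : Prop :=
  forall m : nat,
    (forall n : nat, (0 < n)%N -> (0 < q n)%E -> (m %| n)%N) -> m = 1%N.

(* Below, z : nat -> nat is one realization of (Z_n); z 0 is never used. *)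

(* Roots, i.e. the vertices <= 0, are fixed. *)
Definition parent (z : nat -> nat) (v : int) : int :=
  if 0 < v then v - (z `|v|%N)%:Z else v.

(* If every z n is positive, each parent step from a positive vertex decreases
   it by at least 1, so `|v| steps suffice to reach the root; see
   coloring_root and coloring_step for the recursion this satisfies. *)
Definition coloring (z : nat -> nat) (v : int) : int :=
  iter `|v|%N (parent z) v.

Definition tree_size (R : realType) (z : nat -> nat) (i : int) : \bar R :=
  (\sum_(1 <= t <oo) (coloring z t%:Z == i)%:R%:E)%E.

(* A is the vertex set {u 0 < u 1 < ...}: the sequence is indexed from 0. *)
Definition maximal_infinite_path (z : nat -> nat) (A : set nat) : Prop :=
  exists u : nat -> nat,
    [/\ A = range u,
        (0 < u 0)%N /\ (forall k, (u k < u k.+1)%N),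
        forall k, (u k.+1)%:Z - (z (u k.+1))%:Z = (u k)%:Z
      & (u 0)%:Z - (z (u 0))%:Z <= 0].

Lemma iter_parent_root (z : nat -> nat) (i : int) (n : nat) :
  i <= 0 -> iter n (parent z) i = i.
Proof. by move=> i0; elim: n => //= n ->; rewrite /parent ltNge i0. Qed.

Lemma coloring_root (z : nat -> nat) (i : int) : i <= 0 -> coloring z i = i.
Proof. exact: iter_parent_root. Qed.

Lemma iter_parent_coloring (z : nat -> nat) : (forall n, (0 < z n)%N) ->
  forall (n : nat) (v : int), v <= n%:Z -> iter n (parent z) v = coloring z v.
Proof.
move=> z0 n v; have [v0|v0] := leP v 0.
  by rewrite iter_parent_root// coloring_root.
case: v v0 => // m _; rewrite lez_nat => mn.
rewrite /coloring absz_nat -[in LHS](subnK mn) iterD.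
have key k (w : int) : w <= k%:Z -> iter k (parent z) w <= 0.
  elim: k w => [//|k IHk] w wk; rewrite iterSr; apply: IHk; rewrite /parent.
  case: ifPn => [w0|]; last by rewrite -leNgt => /le_trans; apply.
  rewrite lerBlDr; apply: (le_trans wk).
  by rewrite -PoszD lez_nat -addn1 leq_add2l.
by rewrite iter_parent_root// key.
Qed.

Lemma coloring_step (z : nat -> nat) (n : nat) :
  (forall n, (0 < z n)%N) -> (0 < n)%N ->
  coloring z n%:Z = coloring z (n%:Z - (z n)%:Z).
Proof.
move=> z0; case: n => // n _; rewrite {1}/coloring absz_nat iterSr.
rewrite {2}/parent ltz_nat absz_nat /=; apply: iter_parent_coloring => //.
by rewrite lerBlDr -PoszD lez_nat -addn1 leq_add2l.
Qed.

(* Main.v *)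
Require Import Defs.
From HB Require Import structures.
From mathcomp Require Import all_boot all_order all_algebra.
From mathcomp Require Import all_classical all_reals all_analysis.
From mathcomp Require Import measurable_realfun zify.
Import Order.TTheory GRing.Theory Num.Theory.
Import numFieldNormedType.Exports.
Local Open Scope classical_set_scope.
Local Open Scope ring_scope.

(** The forest is a function of the sequence x of steps. Call a vertex
    surviving when it has infinitely many descendants. Survival of n depends
    only on the steps after n, so it is independent of the step x n taken at n,
    and by shift invariance its probability is the same number rho for every
    n >= 0; for n = 0 it is the probability that the tree of 0 is infinite.
    Hence the expected number of surviving n >= 1 whose parent is a root is
    rho * sum_n P(Z >= n) = rho * E Z ([crossing_sum]), and the theorem comes
    down to this count.

    Finite mean. Since the support of Z has gcd 1, large integers are sums of
    elements of the support, so a prescription of finitely many steps after a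
    vertex c sends a long block of consecutive vertices to c. Finiteness of the
    mean then makes it likely that no later step jumps over that block, in which
    case all vertices far enough from c descend from c. This has positive
    probability, the same for all c, so by the zero-one law it happens for
    infinitely many c almost surely ([trunk_cofinal_as]). These c line up on a
    single infinite path, which is contained in a single tree: the infinite tree
    and the maximal infinite path exist and are unique, and exactly one
    surviving vertex has a root as parent ([trunk_first]). So rho * E Z = 1.

    Infinite mean with all steps possible. A vertex has finitely many children
    almost surely, so a surviving vertex has a surviving child; but its expected
    number of surviving children is at most rho, the probability that it
    survives. Hence it almost surely never has two ([surviving_siblings]). If
    two surviving vertices m < n could both have roots as parents, then
    replacing their two steps by m and n, which are independent of the survival
    of both, would make them siblings. So at most one surviving vertex has a
    root as parent ([surviving_crossings]), rho * E Z <= 1, and rho = 0. *)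

(** * Ancestors, surviving vertices and trunks of a fixed forest *)

Section ancestors.
Variable x : nat -> nat.
Implicit Types v w : int.

Definition ancestor v w := exists k, iter k (parent x) w = v.

Lemma parent_le w : parent x w <= w.
Proof. by rewrite /parent; case: ifP => //; lia. Qed.

Lemma parent_pos (n : nat) : (0 < n)%N -> parent x n%:Z = n%:Z - (x n)%:Z.
Proof. by rewrite /parent ltz_nat => ->; rewrite absz_nat. Qed.

Lemma ancestor_refl v : ancestor v v.
Proof. by exists 0%N. Qed.

Lemma ancestor_trans u v w : ancestor u v -> ancestor v w -> ancestor u w.
Proof. by move=> [k <-] [l <-]; exists (k + l)%N; rewrite iterD. Qed.

Lemma ancestor_parent w : ancestor (parent x w) w.
Proof. by exists 1%N. Qed.

Lemma ancestor_le v w : ancestor v w -> v <= w.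
Proof.
by move=> [k <-]; elim: k => //= k IH; exact: le_trans (parent_le _) IH.
Qed.

Lemma ancestor_neq v w : ancestor v w -> v != w -> ancestor v (parent x w).
Proof.
by move=> [[|k]] <-; rewrite ?eqxx// iterSr; exists k.
Qed.

Lemma ancestor_linear u v w :
  ancestor u w -> ancestor v w -> u <= v -> ancestor u v.
Proof.
move=> [k <-] [l <-] uv; have [lk|kl] := leqP l k.
  by exists (k - l)%N; rewrite -iterD subnK.
have le : iter l (parent x) w <= iter k (parent x) w.
  by rewrite -(subnK (ltnW kl)) iterD; apply: ancestor_le; exists (l - k)%N.
by exists 0%N; apply/eqP; rewrite /= eq_le uv le.
Qed.

Lemma ancestor_of_root v w : w <= 0 -> ancestor v w -> v = w.
Proof. by move=> w0 [k <-]; rewrite iter_parent_root. Qed.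

Lemma ancestor_root_unique u v w :
  u <= 0 -> v <= 0 -> ancestor u w -> ancestor v w -> u = v.
Proof.
move=> u0 v0 uw vw; case: (leP u v) => uv.
  exact: ancestor_of_root (ancestor_linear _ _ _ uw vw uv).
by apply/esym/ancestor_of_root/(ancestor_linear _ _ _ vw uw (ltW uv)).
Qed.

(** The bridge between the coloring, which iterates the parent map a number of
    times fixed in advance, and ancestry. *)
Lemma ancestor_coloring v w : (forall n, 0 < x n)%N ->
  v <= 0 -> ancestor v w <-> coloring x w = v.
Proof.
move=> x0 v0; split=> [[k kv]|<-]; last by exists `|w|%N.
rewrite -(@iter_parent_coloring x x0 (`|w| + k)%N); last by lia.
by rewrite iterD kv iter_parent_root.
Qed.

Lemma coloring_le0 w : (forall n, 0 < x n)%N -> coloring x w <= 0.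
Proof.
move=> x0; have [w0|w0] := leP w 0; first by rewrite coloring_root.
have key k u : u <= k%:Z -> iter k (parent x) u <= 0.
  elim: k u => [//|k IHk] u uk; rewrite iterSr; apply: IHk; rewrite /parent.
  by case: ifPn => u0; [have := x0 `|u|%N; lia|lia].
by apply: key; lia.
Qed.

Lemma ancestor_child v (t : nat) : v <= 0 -> (0 < t)%N -> ancestor v t%:Z ->
  exists n : nat, [/\ (0 < n)%N, parent x n%:Z = v & ancestor n%:Z t%:Z].
Proof.
move=> v0 t0 [k]; elim: k t t0 => [|k IH] t t0; first by rewrite /=; lia.
rewrite iterSr => kv; have [p0|p0] := leP (parent x t) 0.
  by exists t; split=> //; [rewrite -kv iter_parent_root|exact: ancestor_refl].
have [n [n0 pn nt]] := IH `|parent x t|%N ltac:(lia) ltac:(by rewrite gtz0_abs).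
exists n; split=> //; apply: ancestor_trans nt _.
by rewrite gtz0_abs//; exact: ancestor_parent.
Qed.

Definition infinite_offspring v :=
  forall N : nat, exists2 t : nat, (N <= t)%N & ancestor v t%:Z.

(** A vertex of the trunk is an ancestor of all late vertices, so that any two
    of them lie on a common descending line. *)
Definition trunk v :=
  exists N : nat, forall t : nat, (N <= t)%N -> ancestor v t%:Z.

Lemma trunk_ancestor u v : ancestor u v -> trunk v -> trunk u.
Proof. by move=> uv [N H]; exists N => t /H; exact: ancestor_trans. Qed.

Lemma trunk_linear u v : trunk u -> trunk v -> u <= v -> ancestor u v.
Proof.
move=> [M uM] [N vN].
exact: ancestor_linear (uM _ (leq_maxl M N)) (vN _ (leq_maxr M N)).
Qed.

Lemma trunk_infinite v : trunk v -> infinite_offspring v.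
Proof.
by move=> [M vM] N; exists (maxn M N); [exact: leq_maxr|exact/vM/leq_maxl].
Qed.

(** Pigeonhole: if the root [- k] has finitely many children, one of them
    inherits infinitely many of its descendants. *)
Lemma infinite_offspring_child (k : nat) : infinite_offspring (- k%:Z) ->
  ~ (forall N, exists2 n, (N <= n)%N & x n = (n + k)%N) ->
  exists n : nat, [/\ (0 < n)%N, x n = (n + k)%N & infinite_offspring n%:Z].
Proof.
move=> inf /existsNP[M fin]; apply: contrapT => nex.
have /choice[f fP] (n : nat) : exists N : nat, (0 < n)%N -> x n = (n + k)%N ->
    forall t : nat, (N <= t)%N -> ~ ancestor n%:Z t%:Z.
  have [[n0 xn]|h] := pselect ((0 < n)%N /\ x n = (n + k)%N); last first.
    by exists 0%N => n0 xn; case: h.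
  have /existsNP[N hN] : ~ infinite_offspring n%:Z by move=> i; apply: nex; exists n.
  by exists N => _ _ t Nt nt; apply: hN; exists t.
have [t] := inf (\max_(n < M) f n).+1.
move=> ft /ancestor_child[]; [by lia|by lia|move=> n [n0 pn nt]].
have xn : x n = (n + k)%N by move: pn; rewrite parent_pos//; lia.
have nM : (n < M)%N by rewrite ltnNge; apply/negP => Mn; apply: fin; exists n.
apply: (fP n n0 xn t) => //; apply: leq_trans (ltnW ft).
exact: (leq_bigmax (Ordinal nM)).
Qed.

Definition trunk_cofinal :=
  forall M : nat, exists2 c : nat, (M <= c)%N & trunk c%:Z.

Section cofinal_trunk.
Hypothesis x_gt0 : forall n, (0 < x n)%N.
Hypothesis cofinal : trunk_cofinal.

(** A vertex v with infinitely many descendants has one beyond the threshold of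
    some trunk vertex c > v; both are ancestors of it, hence v is an ancestor
    of c. *)
Lemma infinite_offspring_trunk v : infinite_offspring v -> trunk v.
Proof.
move=> vinf; have [c vc tc] := cofinal `|v|%N.
have [N cN] := tc; have [t Nt vt] := vinf N.
by apply: trunk_ancestor tc; apply: (ancestor_linear _ _ _ vt (cN t Nt)); lia.
Qed.

Lemma trunk_root : exists! i, i <= 0 /\ trunk i.
Proof.
have [c _ tc] := cofinal 0%N.
have root : trunk (coloring x c).
  by apply: trunk_ancestor tc; apply/ancestor_coloring => //; exact: coloring_le0.
exists (coloring x c); split=> [|j [j0 [N jN]]].
  by split=> //; exact: coloring_le0.
have [M iM] := root.
apply: (ancestor_root_unique _ _ _ _ _
  (iM _ (leq_maxl M N)) (jN _ (leq_maxr M N))) => //.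
exact: coloring_le0.
Qed.

Definition trunk_nat := [set n : nat | (0 < n)%N /\ trunk n%:Z].

Lemma trunk_nat_parent (n : nat) : trunk_nat n -> 0 < parent x n ->
  trunk_nat `|parent x n|%N.
Proof.
move=> [n0 tn] p0; split; first by lia.
by rewrite gtz0_abs//; apply: trunk_ancestor tn; exact: ancestor_parent.
Qed.

Lemma trunk_nat_next (m : nat) : exists n, [/\ trunk_nat n, (m < n)%N &
  forall l, trunk_nat l -> (m < l)%N -> (n <= l)%N].
Proof.
have [c mc tc] := cofinal m.+1.
pose p n := `[< trunk_nat n /\ (m < n)%N >].
have ex : exists n, p n by exists c; apply/asboolP; split=> //; split=> //; lia.
case: (ex_minnP ex) => n /asboolP[tn mn] minn.
by exists n; split=> // l tl ml; apply: minn; apply/asboolP.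
Qed.

Lemma trunk_first : exists n, [/\ trunk_nat n, parent x n <= 0 &
  forall l, trunk_nat l -> parent x l <= 0 -> l = n].
Proof.
have [n [tn n0 minn]] := trunk_nat_next 0%N.
have pn : parent x n <= 0.
  rewrite leNgt; apply/negP => p0; have [] := trunk_nat_parent _ tn p0.
  have := minn _ (trunk_nat_parent _ tn p0).
  by rewrite parent_pos// in p0 *; have := x_gt0 n; lia.
exists n; split=> // l [l0 tl] pl; apply: contrapT => ln.
have nl : (n <= l)%N by exact: minn.
have : ancestor n%:Z (parent x l).
  apply: ancestor_neq; last by apply/eqP; lia.
  by apply: trunk_linear tl _; [case: tn|lia].
by move=> /ancestor_le; lia.
Qed.

(** The positive trunk vertices, listed in increasing order, form the path: the
    parent of each is again in the trunk and at least the previous one, hence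
    equal to it. *)
Lemma trunk_is_path : maximal_infinite_path x trunk_nat.
Proof.
have [f fP] := choice trunk_nat_next.
pose u k := iter k f (f 0%N).
have tu k : trunk_nat (u k).
  by rewrite /u; case: k => [|k] /=;
    [case: (fP 0%N)|case: (fP (iter k f (f 0%N)))].
have us k : (u k < u k.+1)%N by rewrite /u /=; case: (fP (iter k f (f 0%N))).
have u0 : (0 < u 0%N)%N by case: (tu 0%N).
exists u; split=> //.
- apply/seteqP; split=> [v tv|_ [k _ <-]//].
  have vk k : (v <= u k)%N -> range u v.
    elim: k => [|k IH] vk.
      exists 0%N => //; apply/eqP; rewrite eqn_leq vk andbT.
      by have [_ _] := fP 0%N; apply => //; case: tv.
    have [vlek|kltv] := leqP v (u k); first exact: IH.
    exists k.+1 => //; apply/eqP; rewrite eqn_leq vk andbT.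
    by have [_ _] := fP (u k); apply.
  by apply: (vk v); elim: (v) => // n IH; exact: leq_ltn_trans IH (us n).
- move=> k; rewrite -parent_pos; last by case: (tu k.+1).
  have [_ tk] := tu k; have [_ tk1] := tu k.+1.
  have anc : ancestor (u k)%:Z (parent x (u k.+1)).
    apply: ancestor_neq; last by apply/eqP; have := us k; lia.
    by apply: trunk_linear => //; have := us k; lia.
  have le := ancestor_le _ _ anc.
  have uk0 : (0 < u k)%N by case: (tu k).
  have tp : trunk_nat `|parent x (u k.+1)|%N.
    by apply: trunk_nat_parent => //; lia.
  have lt : parent x (u k.+1) < (u k.+1)%:Z.
    have uk1 : (0 < u k.+1)%N by case: (tu k.+1).
    by rewrite parent_pos//; have := x_gt0 (u k.+1); lia.
  apply/eqP; rewrite eq_le le andbT leNgt; apply/negP => ltk.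
  have [_ _ /(_ _ tp)] := fP (u k); rewrite -[f (u k)]/(u k.+1) => h.
  by have := h ltac:(lia); lia.
- have [n [[n0 tn] pn _]] := trunk_first.
  rewrite -parent_pos//; have [_ _ /(_ n)] := fP 0%N.
  move=> /(_ (conj n0 tn) n0); rewrite -[f 0%N]/(u 0%N) => le0.
  have anc : ancestor (u 0%N)%:Z n by apply: trunk_linear; [case: (tu 0%N)| |lia].
  have [->//|ne] := eqVneq (u 0%N) n.
  have ne' : (u 0%N)%:Z != n%:Z by apply/eqP => -[]; apply/eqP.
  by have /ancestor_le := ancestor_neq _ _ anc ne'; lia.
Qed.

(** Vertices of an infinite path survive, hence are in the trunk; conversely a
    trunk vertex is an ancestor of some vertex of the path, and the path
    contains the positive ancestors of its vertices. *)
Lemma maximal_infinite_path_trunk A : maximal_infinite_path x A -> A = trunk_nat.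
Proof.
move=> [u [-> [u0 us] ustep ufirst]].
have ugt k : (k < u k)%N by elim: k => // k IH; exact: leq_ltn_trans IH (us k).
have pu k : parent x (u k.+1) = (u k)%:Z.
  by rewrite parent_pos// (leq_ltn_trans _ (ugt _)).
have anc k l : (k <= l)%N -> ancestor (u k)%:Z (u l)%:Z.
  elim: l => [|l IH]; first by rewrite leqn0 => /eqP ->; exact: ancestor_refl.
  rewrite leq_eqVlt => /predU1P[->|]; first exact: ancestor_refl.
  rewrite ltnS => /IH kl; apply: ancestor_trans kl _.
  by rewrite -pu; exact: ancestor_parent.
apply/seteqP; split=> [_ [k _ <-]|v [v0 [N vN]]].
  split; first by rewrite (leq_ltn_trans _ (ugt _)).
  apply: infinite_offspring_trunk => N; exists (u (maxn k N)).
    by rewrite (leq_trans (leq_maxr k N))// ltnW.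
  by apply: anc; exact: leq_maxl.
have : ancestor v (u N) by apply: vN; exact: ltnW.
elim: N {vN} => [|l IH] vl.
  have [vu|ne] := eqVneq v%:Z (u 0%N)%:Z; first by exists 0%N => //; case: vu.
  have /ancestor_le := ancestor_neq _ _ vl ne.
  have uf : (u 0%N)%:Z - (x (u 0%N))%:Z <= 0 := ufirst.
  by rewrite parent_pos// => v_le; exfalso; lia.
have [vu|ne] := eqVneq v%:Z (u l.+1)%:Z; first by exists l.+1 => //; case: vu.
by apply: IH; rewrite -pu; exact: ancestor_neq.
Qed.

End cofinal_trunk.
End ancestors.

(** Only the steps of the descendants of v matter. This gives both the
    measurability of survival and its insensitivity to a step elsewhere. *)
Lemma ancestor_congr (x y : nat -> nat) (v : int) (t : nat) :
  (forall j : nat, v < j%:Z -> (0 < j <= t)%N -> ancestor x v j%:Z ->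
    x j = y j) ->
  ancestor x v t%:Z -> ancestor y v t%:Z.
Proof.
move=> xy [k]; elim: k t xy => [|k IH] t xy.
  by move=> <-; exact: ancestor_refl.
have [->|vt] := eqVneq v t%:Z; first by move=> _; exact: ancestor_refl.
case: t => [|t] in xy vt *.
  by rewrite iter_parent_root// => vE; rewrite vE eqxx in vt.
move=> kv; have vat : ancestor x v t.+1 by exists k.+1.
have xyt : x t.+1 = y t.+1.
  by apply: xy => //; [have := ancestor_le _ _ _ vat; lia|lia].
have pxy : parent x t.+1 = parent y t.+1 by rewrite !parent_pos// xyt.
apply: ancestor_trans (ancestor_parent y t.+1); rewrite -pxy.
move: kv; rewrite iterSr; have := parent_le x t.+1.
case E : (parent x t.+1) => [p|p] ple.
  by move=> kp; apply: IH kp => j vj jp; apply: xy => //; lia.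
by rewrite iter_parent_root// => <-; exact: ancestor_refl.
Qed.

Definition shift (n : nat) (x : nat -> nat) : nat -> nat := fun i => x (i + n)%N.

(** Vertices at or above n see n as the root 0 of the shifted forest, because
    paths never go back up. *)
Lemma ancestor_shift (n : nat) (x : nat -> nat) (v t : nat) :
  ancestor (shift n x) v t <-> ancestor x (v + n)%N (t + n)%N.
Proof.
split=> -[k]; elim: k t => [|k IH] t.
- by move=> /= [->]; exact: ancestor_refl.
- case: t => [|t]; first by rewrite iter_parent_root// => -[->]; exact: ancestor_refl.
  rewrite iterSr parent_pos//; case E : (_ - _) => [p|p] kp.
    apply: ancestor_trans (IH _ kp) _.
    have -> : (p + n)%N%:Z = parent x (t.+1 + n)%N.
      by rewrite parent_pos; [move: E; rewrite /shift; lia|lia].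
    exact: ancestor_parent.
  by move: kp; rewrite iter_parent_root.
- move=> /= tv; have vt : v = t by lia.
  by rewrite vt; exact: ancestor_refl.
- have [->|tv] := eqVneq v t; first by move=> _; exact: ancestor_refl.
  case: t => [|t] in tv *.
    move=> kv; have : ancestor x (v + n)%N (0 + n)%N by exists k.+1.
    by move/ancestor_le; lia.
  rewrite iterSr parent_pos; last by lia.
  move=> kv; have ge : (v + n)%N%:Z <= (t.+1 + n)%N%:Z - (x (t.+1 + n)%N)%:Z.
    by apply: (ancestor_le x); exists k.
  have E : (t.+1 + n)%N%:Z - (x (t.+1 + n)%N)%:Z =
      (`|t.+1%:Z - (x (t.+1 + n)%N)%:Z| + n)%N%:Z by lia.
  rewrite E in kv; apply: ancestor_trans (IH _ kv) _.
  have -> : `|t.+1%:Z - (x (t.+1 + n)%N)%:Z|%N%:Z = parent (shift n x) t.+1.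
    by rewrite parent_pos// /shift; lia.
  exact: ancestor_parent.
Qed.

Lemma infinite_offspring_shift (n : nat) (x : nat -> nat) :
  infinite_offspring x n <-> infinite_offspring (shift n x) 0.
Proof.
split=> inf N.
  have [t Nt nt] := inf (N + n)%N.
  exists (t - n)%N; first by lia.
  by apply/ancestor_shift; rewrite add0n subnK//; lia.
have [t Nt nt] := inf N; exists (t + n)%N; first by lia.
by move/ancestor_shift: nt.
Qed.

(** * Events forcing a vertex to be an ancestor of all late vertices *)

Section semigroup.
Local Open Scope nat_scope.
Variable Q : set nat.
Hypothesis Qpos : forall s, Q s -> 0 < s.
Hypothesis Qgcd : forall m, (forall s, Q s -> m %| s) -> m = 1.

Inductive generated : nat -> Prop :=
| generated0 : generated 0
| generatedD s k of Q s & generated k : generated (s + k).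

Lemma generated_add k l : generated k -> generated l -> generated (k + l).
Proof.
by move=> gk gl; elim: gk => // s m Qs _; rewrite -addnA; exact: generatedD.
Qed.

Lemma generated_mul p k : generated k -> generated (p * k).
Proof.
move=> gk; elim: p => [|p IH]; first exact: generated0.
by rewrite mulSn; exact: generated_add.
Qed.

Lemma generated_base s : Q s -> generated s.
Proof. by move=> Qs; rewrite -(addn0 s); apply: generatedD Qs generated0. Qed.

(** The least positive difference m between two generated numbers divides all
    of Q: a nonzero remainder s mod m would be a smaller difference. *)
Lemma generated_consecutive : exists a, generated a /\ generated a.+1.
Proof.
pose p m := `[< 0 < m /\ exists a, generated a /\ generated (a + m) >].
have exp : exists m, p m.
  have [s Qs] : exists s, Q s.
    apply: contrapT => /forallNP Q0.
    (* if Q were empty, 2 would divide all its elements *)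
    by have := @Qgcd 2 (fun s Qs => False_ind _ (Q0 s Qs)).
  exists s; apply/asboolP; split; first exact: Qpos.
  by exists 0; split; [exact: generated0|exact: generated_base].
case: (ex_minnP exp) => m /asboolP[m0 [a [ga gam]]] min_m.
suff m1 : m = 1 by exists a; rewrite m1 addn1 in gam.
apply: Qgcd => s Qs; apply: contrapT => /negP; rewrite /dvdn -lt0n => r0.
suff : p (s %% m) by move/min_m; rewrite leqNgt ltn_pmod.
apply/asboolP; split=> //; exists (s %/ m * (a + m)); split.
  exact: generated_mul.
have -> : s %/ m * (a + m) + s %% m = s + s %/ m * a.
  by rewrite {3}(divn_eq s m); lia.
by apply: generated_add; [exact: generated_base|exact: generated_mul].
Qed.

(** With a and a + 1 generated, every k >= a ^ 2 is: write k = q * a + r with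
    r < a <= q and use r copies of a + 1. *)
Lemma generated_cofinite : exists N, forall k, N <= k -> generated k.
Proof.
have [a [ga ga1]] := generated_consecutive.
have [a0|a0] := posnP a.
  by exists 0 => k _; rewrite -(muln1 k); apply: generated_mul; rewrite a0 in ga1.
exists (a * a) => k ak; have ra := ltn_pmod k a0.
have aq : a <= k %/ a by rewrite leq_divRL.
have -> : k = (k %/ a - k %% a) * a + k %% a * a.+1.
  by rewrite {1}(divn_eq k a) mulnS mulnBl addnCA addnC subnK// leq_mul2r; lia.
by apply: generated_add; exact: generated_mul.
Qed.

Lemma generated_step k : 0 < k -> generated k ->
  exists s, [/\ Q s, s <= k & generated (k - s)].
Proof.
move=> + gk; case: gk => // s l Qs gl _.
by exists s; rewrite leq_addr addKn.
Qed.

End semigroup.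

Section funnel.
Local Open Scope nat_scope.
Variables (Q : set nat) (step : nat -> nat) (N W : nat).
Hypothesis Qpos : forall s, Q s -> 0 < s.
Hypothesis stepP : forall k, 0 < k -> generated Q k ->
  [/\ Q (step k), step k <= k & generated Q (k - step k)].
Hypothesis cofinite : forall k, N <= k -> generated Q k.

(** Conditions on the steps of c + 1, c + 2, ... that lead all late vertices to
    c. A vertex c + k with k <= N + W and k generated starts a descent to c
    along generated offsets; in particular all of the W + 1 vertices from c + N
    to c + N + W end up in c. Beyond, a step below k - N does not pass c + N, so
    it lands on a generated offset again. *)
Definition funnel k : set nat :=
  if k <= N + W then [set z | generated Q k -> z = step k]
  else [set z | 0 < z < k - N].

Definition funnel_event c : set (nat -> nat) :=
  [set x | forall k, 0 < k -> funnel k (x (c + k))].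

Lemma funnel_trunk c (x : nat -> nat) : funnel_event c x -> trunk x c%:Z.
Proof.
move=> fx; suff key k : generated Q k -> ancestor x c%:Z (c + k)%N%:Z.
  exists (c + N) => t Nt; rewrite -(subnKC (leq_trans (leq_addr N c) Nt)).
  by apply: key; apply: cofinite; lia.
have [n kn] := ubnP k; elim: n => // n IH in k kn *; move=> gk.
have [->|k0] := posnP k; first by rewrite addn0; exact: ancestor_refl.
have [z0 zk gz] : [/\ 0 < x (c + k), x (c + k) <= k & generated Q (k - x (c + k))].
  have := fx k k0; rewrite /funnel; case: ifPn => kW.
    by move=> /(_ gk) ->; have [/Qpos] := stepP k k0 gk.
  by move=> /andP[z0 zk]; split=> //; [lia|apply: cofinite; lia].
have : ancestor x c%:Z (c + (k - x (c + k)))%N%:Z by apply: IH => //; lia.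
move=> /ancestor_trans; apply.
have -> : (c + (k - x (c + k)))%N%:Z = parent x (c + k)%N.
  by rewrite parent_pos; lia.
exact: ancestor_parent.
Qed.

End funnel.

(** * Sequences of independent identically distributed steps *)

Definition cylinder (s : seq nat) (B : nat -> set nat) : set (nat -> nat) :=
  [set x | forall i, i \in s -> B i (x i)].

Definition cylinders (J : set nat) : set (set (nat -> nat)) :=
  [set C | exists s B, (forall i, i \in s -> J i) /\ C = cylinder s B].

(** Events determined by the steps with index in J. *)
Definition sigma (J : set nat) : set (set (nat -> nat)) := <<s cylinders J >>.

Definition seqspace := g_sigma_algebraType (cylinders setT).
HB.instance Definition _ := Measurable.on seqspace.

Lemma cylinders_setI J : setI_closed (cylinders J).
Proof.
move=> _ _ [s [B [sJ ->]]] [t [D [tJ ->]]].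
exists (s ++ t), (fun i => [set n | (i \in s -> B i n) /\ (i \in t -> D i n)]).
split=> [i|]; first by rewrite mem_cat => /orP[/sJ|/tJ].
apply/seteqP; split=> [x [Bx Dx] i _|x BDx]; first by split=> [/Bx|/Dx].
by split=> i it; have := BDx i; rewrite mem_cat it ?orbT => /(_ isT)[]; auto.
Qed.

Lemma cylinders_setT J : cylinders J setT.
Proof. by exists [::], (fun=> setT); split=> //; apply/seteqP; split. Qed.

Lemma cylinders_sub J J' : J `<=` J' -> cylinders J `<=` cylinders J'.
Proof. by move=> JJ' _ [s [B [sJ ->]]]; exists s, B; split=> // i /sJ/JJ'. Qed.

Lemma sigma_sub J J' : J `<=` J' -> sigma J `<=` sigma J'.
Proof. by move=> JJ'; apply: sub_sigma_algebra2; exact: cylinders_sub. Qed.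

Lemma sigma_measurable J E : sigma J E -> measurable (E : set seqspace).
Proof. exact: sigma_sub (@subsetT _ J) E. Qed.

Lemma sigma_bigcup J (U : countType) (F : U -> set (nat -> nat)) :
  (forall i, sigma J (F i)) -> sigma J (\bigcup_i F i).
Proof.
exact: (@countable_bigcupT_measurable _ (g_sigma_algebraType (cylinders J))).
Qed.

Lemma sigma_bigcap J (F : nat -> set (nat -> nat)) (D : set nat) :
  (forall i, D i -> sigma J (F i)) -> sigma J (\bigcap_(i in D) F i).
Proof.
exact: (@bigcap_measurableType _ (g_sigma_algebraType (cylinders J))).
Qed.

Lemma sigma_coord J (i : nat) (B : set nat) : J i -> sigma J [set x | B (x i)].
Proof.
move=> Ji; apply: sub_sigma_algebra; exists [:: i], (fun=> B); split.
  by move=> j; rewrite inE => /eqP ->.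
apply/seteqP; split=> x /=; first by move=> Bx j; rewrite inE => /eqP ->.
by move=> /(_ i); rewrite inE eqxx; exact.
Qed.

(** There are countably many values for finitely many coordinates. *)
Lemma sigma_local J (s : seq nat) (E : set (nat -> nat)) :
  (forall i, i \in s -> J i) ->
  (forall x y, {in s, x =1 y} -> E x -> E y) -> sigma J E.
Proof.
move=> sJ loc.
(* the sequences that agree on s with the list v, padded with zeros *)
pose F (v : seq nat) := if `[< E (nth 0%N v) >] then
  cylinder s (fun i => [set nth 0%N v i]) else set0.
have -> : E = \bigcup_v F v.
  apply/seteqP; split=> [x Ex|x [v _]]; rewrite /F.
    exists (mkseq x (\max_(i <- s) i).+1) => //.
    have xv : {in s, x =1 nth 0%N (mkseq x (\max_(i <- s) i).+1)}.
      by move=> i si; rewrite nth_mkseq// ltnS; exact: leq_bigmax_seq.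
    by case: asboolP => [_ i|[]]; [exact: xv|exact: loc xv Ex].
  case: asboolP => // Ev vx; apply: loc Ev => i /vx /= ->//.
apply: sigma_bigcup => v; rewrite /F; case: ifP => _; last exact: sigma_algebra0.
by apply: sub_sigma_algebra; exists s, (fun i => [set nth 0%N v i]).
Qed.

Lemma sigma_preimage J J' (phi : (nat -> nat) -> (nat -> nat)) :
  (forall i B, J i -> sigma J' [set x | B (phi x i)]) ->
  forall E, sigma J E -> sigma J' (phi @^-1` E).
Proof.
move=> phiJ; pose T' := g_sigma_algebraType (cylinders J').
suff : sigma J `<=` [set E | measurable (phi @^-1` E : set T')] by [].
apply: smallest_sub.
  split=> [|A mA|F mF] /=; first by rewrite preimage_set0.
    by rewrite setTD preimage_setC; exact: measurableC.
  by rewrite preimage_bigcup; exact: bigcupT_measurable.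
move=> _ [s [B [sJ ->]]] /=.
have -> : phi @^-1` cylinder s B = \bigcap_(i in [set` s]) [set x | B i (phi x i)].
  by apply/seteqP; split.
by apply: sigma_bigcap => i /= /sJ; exact: phiJ.
Qed.

Section iid.
Local Open Scope ereal_scope.
Context {R : realType}.
Variable mu : probability seqspace R.
Let nu (B : set nat) := mu [set x | B (x 0%N)].
Hypothesis iid : forall s B, uniq s -> mu (cylinder s B) = \prod_(i <- s) nu (B i).

Lemma mu_fin E : sigma setT E -> mu E \is a fin_num.
Proof. exact: (fin_num_measure mu). Qed.

Lemma cylinder_indep J J' C C' : (forall i, J i -> J' i -> False) ->
  cylinders J C -> cylinders J' C' -> mu (C `&` C') = mu C * mu C'.
Proof.
move=> disj [s [B [sJ ->]]] [t [D [tJ ->]]].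
have cu u E : cylinder u E = cylinder (undup u) E.
  by apply/seteqP; split=> x ux i iu; apply: ux; rewrite mem_undup in iu *.
rewrite (cu s B) (cu t D) !iid ?undup_uniq//.
have st i : i \in s -> i \in t -> False by move=> /sJ Ji /tJ; exact: disj.
have -> : cylinder (undup s) B `&` cylinder (undup t) D =
    cylinder (undup s ++ undup t) (fun i => if i \in s then B i else D i).
  apply/seteqP; split=> [x [Bx Dx] i|x h].
    rewrite mem_cat !mem_undup => /orP[is_|it].
      by rewrite is_; apply: Bx; rewrite mem_undup.
    by case: ifPn => [/st/(_ it)//|_]; apply: Dx; rewrite mem_undup.
  split=> i; rewrite mem_undup => ii; have := h i; rewrite mem_cat !mem_undup ii ?orbT.
    exact.
  by case: ifPn => [/st/(_ ii)//|_]; exact.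
rewrite iid; last first.
  rewrite cat_uniq !undup_uniq andbT/=; apply/hasPn => i; rewrite !mem_undup => it.
  by apply/negP => /st; exact.
rewrite big_cat/=; congr (_ * _); apply: eq_big_seq => i; rewrite mem_undup.
  by move=> ->.
by move=> it; case: ifPn => [/st/(_ it)//|].
Qed.

(** Both sides are finite measures of E that agree on a pi-system. *)
Lemma indep_pi J A : sigma setT A ->
  (forall C, cylinders J C -> mu (C `&` A) = mu C * mu A) ->
  forall E, sigma J E -> mu (E `&` A) = mu E * mu A.
Proof.
move=> mA CA E sE.
have r0 : (0 <= fine (mu A))%R by exact: fine_ge0.
have rE X : mscale (NngNum r0) mu X = mu X * mu A.
  by rewrite /mscale/= fineK ?mu_fin// muleC.
rewrite -rE; apply: (@g_sigma_algebra_measure_unique _ _ seqspace (cylinders J)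
  _ (fun=> setT) _ _ (mrestr mu mA) (mscale (NngNum r0) mu)) => //.
- by move=> C JC; apply: sigma_measurable; apply: sub_sigma_algebra JC.
- by move=> _; exact: cylinders_setT.
- by rewrite bigcup_const//; exists 0%N.
- exact: cylinders_setI.
- by move=> C JC; apply: (etrans (CA _ JC)); exact/esym/rE.
- move=> _; rewrite /= /mrestr setTI.
  by rewrite (le_lt_trans (probability_le1 _ _)) ?ltry.
Qed.

Lemma indep J J' A B : (forall i, J i -> J' i -> False) ->
  sigma J A -> sigma J' B -> mu (A `&` B) = mu A * mu B.
Proof.
move=> disj sA sB; apply: (indep_pi J) => //; first exact: sigma_measurable sB.
move=> C JC; rewrite setIC muleC; apply: (indep_pi J') => //.
  by apply: (sigma_measurable J); exact: sub_sigma_algebra.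
move=> D JD; rewrite setIC muleC; exact: cylinder_indep JC JD.
Qed.

(** A tail event is independent of every cylinder, hence of itself. *)
Lemma kolmogorov01 A : (forall N, sigma [set i | (N <= i)%N] A) -> 0 < mu A ->
  mu A = 1.
Proof.
move=> tail A0; have mA : sigma setT A by exact: sigma_measurable (tail 0%N).
have AA : mu (A `&` A) = mu A * mu A.
  apply: (indep_pi setT) => // C [s [B [_ ->]]].
  apply: (indep [set i | (i <= \max_(i <- s) i)%N] _ _ _ _ _
    (tail (\max_(i <- s) i).+1)).
    by move=> i /= ? ?; lia.
  apply: sub_sigma_algebra; exists s, B; split=> // i si /=.
  exact: leq_bigmax_seq.
rewrite setIid in AA.
have : mu A \is a fin_num by exact: mu_fin.
move: AA A0; case: (mu A) => // r; rewrite -EFinM lte_fin => -[rr] r0 _.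
by congr _%:E; apply: (mulfI (lt0r_neq0 r0)); rewrite mulr1.
Qed.

Lemma mu_shift n E : sigma setT E -> mu (shift n @^-1` E) = mu E.
Proof.
move=> mE.
have mshift : measurable_fun setT (shift n : seqspace -> seqspace).
  move=> _ Y mY; rewrite setTI; apply: (sigma_preimage setT setT) mY => i B _.
  exact: sigma_coord.
pose f : {mfun seqspace >-> seqspace} := mfun_Sub (mem_set mshift).
apply: (@measure_unique _ _ seqspace (cylinders setT) (fun=> setT) _ _ _ _
  (distribution mu f) mu) => //.
- exact: cylinders_setI.
- by move=> _; exact: cylinders_setT.
- by rewrite bigcup_const//; exists 0%N.
- move=> _ [s [B [_ ->]]]; rewrite /distribution /pushforward.
  have cu : cylinder s B = cylinder (undup s) B.
    by apply/seteqP; split=> x ux i iu; apply: ux; rewrite mem_undup in iu *.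
  have sE : shift n @^-1` cylinder s B =
      cylinder [seq (i + n)%N | i <- undup s] (fun i => B (i - n)%N).
    apply/seteqP; split=> [x Bx _ /mapP[i + ->]|x Bx i si].
      by rewrite mem_undup addnK; exact: Bx.
    have := Bx (i + n)%N; rewrite addnK; apply; apply/mapP; exists i => //.
    by rewrite mem_undup.
  apply: (etrans (congr1 mu sE)); apply: esym.
  apply: (etrans (congr1 mu cu)); apply: (etrans (iid _ B (undup_uniq s))).
  rewrite iid; last by rewrite map_inj_uniq ?undup_uniq//; exact: addIn.
  by rewrite big_map; apply: eq_bigr => i _; rewrite addnK.
- by move=> _; rewrite /= (le_lt_trans (probability_le1 _ _)) ?ltry.
Qed.

Lemma mu_coord n (B : set nat) : mu [set x | B (x n)] = nu B.
Proof. exact: (mu_shift n [set x | B (x 0%N)] (sigma_coord setT 0%N B I)). Qed.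

End iid.

(** * Almost disjoint events, tail sums and tree sizes *)

Section almost_disjoint.
Local Open Scope ereal_scope.
Context d (T : measurableType d) (R : realType) (P : probability T R).
Variable F : nat -> set T.
Hypothesis mF : forall n, measurable (F n).

(** This lemma and the next are the two halves of the equality case of the
    union bound. *)
Lemma measure_almost_disjoint : (forall m n, (m < n)%N -> P (F m `&` F n) = 0) ->
  \sum_(n <oo) P (F n) = P (\bigcup_n F n).
Proof.
move=> null; rewrite seqDU_bigcup_eq measure_semi_bigcup//; last 2 first.
- exact: seqDU_measurable.
- by apply: bigcupT_measurable; exact: seqDU_measurable.
apply: eq_eseriesr => n _.
have mX : measurable (\big[setU/set0]_(i < n) F i) by exact: bigsetU_measurable.
rewrite (measureDI P (mF n) mX) [X in _ + X](_ : _ = 0) ?adde0//.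
rewrite -bigcup_mkord setI_bigcupr bigcup_mkord.
apply/eqP; rewrite eq_le measure_ge0 andbT.
apply: (le_trans (Boole_inequality P (fun i _ => measurableI _ _ (mF n) (mF i)))).
by rewrite big1// => i _; rewrite /= setIC null.
Qed.

Lemma almost_disjoint_of_sum : \sum_(n <oo) P (F n) <= P (\bigcup_n F n) ->
  forall m n, m != n -> P (F m `&` F n) = 0.
Proof.
move=> sumF m n mn.
(* removing the intersection from F n does not change the union *)
pose G k := if k == n then F n `\` F m else F k.
have mG k : measurable (G k) by rewrite /G; case: ifP => _ //; exact: measurableD.
have GU : \bigcup_k F k `<=` \bigcup_k G k.
  move=> x [k _ Fk]; have [kn|kn] := eqVneq k n; last first.
    by exists k => //; rewrite /G (negbTE kn).
  have [Fm|Fm] := pselect (F m x).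
    by exists m => //; rewrite /G (negbTE mn).
  by exists n => //; rewrite /G eqxx -kn.
have := le_trans sumF (measure_sigma_subadditive P mG (bigcupT_measurable _ mF) GU).
rewrite (@nneseriesD1 _ _ n)// [X in _ <= X](@nneseriesD1 _ _ n)//.
rewrite (_ : G n = F n `\` F m); last by rewrite /G eqxx.
rewrite (measureDI P (mF n) (mF m)).
have -> : \sum_(0 <= k <oo | (k != n)) P (G k) = \sum_(0 <= k <oo | (k != n)) P (F k).
  by apply: eq_eseriesr => k kn; rewrite /G (negbTE kn).
have fin : \sum_(0 <= k <oo | (k != n)) P (F k) \is a fin_num.
  rewrite ge0_fin_numE ?nneseries_ge0//.
  apply: le_lt_trans (_ : P (\bigcup_k F k) < _); last first.
    by rewrite (le_lt_trans (probability_le1 _ _)) ?ltry//; exact: bigcupT_measurable.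
  apply: le_trans sumF; rewrite [X in _ <= X](@nneseriesD1 _ _ n)//.
  by rewrite leeDr.
rewrite leeD2rE// -[X in _ <= X]adde0 leeD2lE//.
  by rewrite setIC => h; apply/eqP; rewrite eq_le h measure_ge0.
by apply: fin_num_measure; exact: measurableD.
Qed.

End almost_disjoint.

(** A natural number X is the sum over n of the indicators of n < X. *)
Lemma expectation_tail_sum d (T : measurableType d) (R : realType)
    (P : probability T R) (X : {RV P >-> nat}) :
  ('E_P[fun w => (X w)%:R] = \sum_(n <oo) P [set w | (n < X w)%N])%E.
Proof.
have mA n : measurable [set w | (n < X w)%N].
  rewrite -[X in measurable X]setTI.
  exact: (measurable_funPT X measurableT [set k | (n < k)%N]).
rewrite unlock.
have -> : (\int[P]_w ((X w)%:R)%:E =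
    \int[P]_w (\sum_(n <oo) (\1_[set w | (n < X w)%N] w)%:E))%E.
  apply: eq_integral => w _.
  rewrite (nneseries_split 0 (X w))//.
  rewrite [X in (_ + X)%E]eseries0 ?adde0; last first.
    move=> i; rewrite add0n => Xi _; rewrite indicE memNset//=.
    by apply/negP; rewrite -leqNgt.
  rewrite add0n sumEFin (eq_big_nat _ _ (F2 := fun=> 1%R)); last first.
    by move=> i /andP[_ iX]; rewrite indicE mem_set.
  by rewrite sumr_const_nat subn0.
rewrite integral_nneseries//; last first.
  by move=> n; apply/measurable_EFinP; exact: measurable_indic.
by apply: eq_eseriesr => n _; rewrite integral_indic// setIT.
Qed.

Lemma tree_size_infty (R : realType) (z : nat -> nat) (i : int) :
  (forall n, (0 < z n)%N) -> i <= 0 ->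
  tree_size R z i = +oo%E <-> infinite_offspring z i.
Proof.
move=> z0 i0; pose f t : \bar R := ((coloring z t%:Z == i)%:R%:E)%E.
have f0 t : (0 <= f t)%E by rewrite lee_fin.
split=> [Soo N|inf].
  apply: contrapT => h; suff : (tree_size R z i < +oo)%E by rewrite Soo.
  rewrite /tree_size (nneseries_split 1 N)//.
  rewrite [X in (_ + X)%E]eseries0 ?adde0; last first.
    move=> t Nt _; rewrite /f; case: eqP => // ct; case: h; exists t.
      by apply: leq_trans Nt; exact: leq_addl.
    by apply/ancestor_coloring.
  by rewrite sumEFin ltry.
have part n : exists M, ((n%:R)%:E <= \sum_(1 <= t < M.+1) f t)%E.
  elim: n => [|n [M nM]]; first by exists 0%N; rewrite big_geq.
  have [t Mt it] := inf M.+1; exists t; rewrite big_nat_recr//=; last exact: leq_trans Mt.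
  have -> : f t = 1%E by rewrite /f (_ : coloring z t = i) ?eqxx//; exact/ancestor_coloring.
  rewrite -natr1 EFinD leeD2r//; apply: le_trans nM _.
  by apply: lee_sum_nneg_natr => //; exact: Mt.
apply/eqyP => A A0; have [M nM] := part (Num.trunc A).+1.
apply: (@le_trans _ _ ((Num.trunc A).+1%:R%:E)%E).
  by rewrite lee_fin ltW// truncnS_gt.
apply: le_trans nM _; apply: nneseries_lim_ge => //.
Qed.

(** * Expected number of surviving vertices with a root as parent *)

Definition surviving (v : int) : set (nat -> nat) :=
  [set x | infinite_offspring x v].

Lemma sigma_const J (p : Prop) : sigma J [set _ | p].
Proof. by apply: (sigma_local J [::]). Qed.

Lemma sigma_setI J A B : sigma J A -> sigma J B -> sigma J (A `&` B).
Proof. exact: (@measurableI _ (g_sigma_algebraType (cylinders J))). Qed.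

Lemma sigma_surviving (v : int) : sigma [set j | v < j%:Z] (surviving v).
Proof.
have -> : surviving v =
    \bigcap_N \bigcup_t [set x | (N <= t)%N /\ ancestor x v t%:Z].
  apply/seteqP; split=> x inf N.
    by move=> _; have [t Nt vt] := inf N; exists t.
  by have [t _ [Nt vt]] := inf N I; exists t.
apply: sigma_bigcap => N _; apply: sigma_bigcup => t.
apply: (sigma_local _ [seq j <- iota 1 t | v < j%:Z]).
  by move=> i; rewrite mem_filter => /andP[].
move=> x y xy [Nt vt]; split=> //; apply: ancestor_congr vt => j vj jt _.
by apply: xy; rewrite mem_filter vj mem_iota; lia.
Qed.

Lemma surviving_measurable v : sigma setT (surviving v).
Proof. exact: sigma_sub (@subsetT _ _) _ (sigma_surviving v). Qed.

Section renewal.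
Local Open Scope ereal_scope.
Context {R : realType}.
Variable mu : probability seqspace R.
Let nu (B : set nat) := mu [set x | B (x 0%N)].
Hypothesis iid : forall s B, uniq s -> mu (cylinder s B) = \prod_(i <- s) nu (B i).

Let rho := mu (surviving 0).

Lemma rho_series (f : nat -> \bar R) : (forall n, 0 <= f n) ->
  \sum_(n <oo) rho * f n = rho * \sum_(n <oo) f n.
Proof.
move=> f0; have <- : (fine rho)%:E = rho.
  by rewrite fineK//; apply: (fin_num_measure mu); exact: surviving_measurable.
by rewrite nneseriesZl.
Qed.

Lemma mu_surviving (n : nat) : mu (surviving n%:Z) = rho.
Proof.
rewrite /rho -(mu_shift mu iid n (surviving 0)); last exact: surviving_measurable.
by congr (mu _); apply/seteqP; split=> x /(infinite_offspring_shift n x).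
Qed.

Definition surviving_jump (n : nat) (B : set nat) : set (nat -> nat) :=
  surviving n%:Z `&` [set x | B (x n)].

Lemma surviving_jump_measurable n B : sigma setT (surviving_jump n B).
Proof. by apply: sigma_setI; [exact: surviving_measurable|exact: sigma_coord]. Qed.

(** The key independence: survival of n involves only the steps after n. *)
Lemma mu_surviving_jump n B : mu (surviving_jump n B) = rho * nu B.
Proof.
rewrite -(mu_surviving n) -[nu _](mu_coord mu iid n B).
apply: (indep mu iid [set j | (n%:Z < j%:Z)%R] [set n]).
- by move=> i /= ni ie; rewrite ie ltxx in ni.
- exact: sigma_surviving.
- exact: sigma_coord.
Qed.

Lemma sum_singletons k : \sum_(n <oo) nu [set (n + k)%N] <= 1.
Proof.
have mF n : measurable ([set x : nat -> nat | x 0%N = (n + k)%N] : set seqspace).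
  exact: (sigma_coord setT 0%N [set (n + k)%N]).
rewrite [leLHS](_ : _ = mu (\bigcup_n [set x : nat -> nat | x 0%N = (n + k)%N])).
  by apply: probability_le1; exact: bigcupT_measurable.
rewrite measure_semi_bigcup//; last exact: bigcupT_measurable.
by apply/trivIsetP => m n _ _ mn; apply/seteqP; split=> // x [/= -> /eqP]; lia.
Qed.

(** By Borel-Cantelli, almost surely only finitely many vertices have [- k] as
    parent, because the probabilities of the steps n + k sum to at most 1. *)
Lemma surviving_has_surviving_child (k : nat) :
  mu (surviving (- k%:Z)) <=
  mu (\bigcup_n surviving_jump n.+1 [set (n.+1 + k)%N]).
Proof.
pose many := lim_sup_set (fun n => [set x : nat -> nat | x n = (n + k)%N]).
have mmany n : sigma setT [set x : nat -> nat | x n = (n + k)%N].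
  exact: (sigma_coord setT n [set (n + k)%N]).
have mU : sigma setT (\bigcup_n surviving_jump n.+1 [set (n.+1 + k)%N]).
  by apply: sigma_bigcup => n; exact: surviving_jump_measurable.
have many0 : mu many = 0.
  apply: lim_sup_set_cvg0 => //.
  rewrite (le_lt_trans _ (ltry (1%R : R)))//; apply: le_trans (sum_singletons k).
  by rewrite (eq_eseriesr (fun n _ => mu_coord mu iid n [set (n + k)%N])).
have mM : sigma setT many.
  by apply: sigma_bigcap => n _; apply: (@bigcup_measurable _ seqspace) => j _; exact: mmany.
rewrite -[leRHS](@measureU0 _ seqspace _ mu _ _ mU mM many0).
apply: le_measure; rewrite ?inE.
- exact: surviving_measurable.
- exact: (@measurableU _ seqspace).
- move=> x sx; have [inf|fin] := pselect
    (forall N, exists2 n, (N <= n)%N & x n = (n + k)%N); [right|left].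
    by move=> N _; have [n Nn xn] := inf N; exists n.
  have [n [n0 xn sn]] := infinite_offspring_child x k sx fin.
  by exists n.-1 => //; rewrite prednK.
Qed.

(* no branching *)
(** No branching: the expected number of surviving children of 0 is at most the
    probability that there is one, so there are not two. *)
Lemma surviving_siblings (m n : nat) : (0 < m)%N -> (m < n)%N ->
  mu (surviving_jump m [set m] `&` surviving_jump n [set n]) = 0.
Proof.
move=> m0 mn.
rewrite -(prednK m0) -(prednK (leq_ltn_trans (leq0n m) mn)).
pose C k := surviving_jump k.+1 [set k.+1].
have mC k : measurable (C k : set seqspace) by exact: surviving_jump_measurable.
apply: (almost_disjoint_of_sum _ _ _ mu C mC); last by apply/eqP; lia.
have := surviving_has_surviving_child 0.
have -> : \bigcup_n surviving_jump n.+1 [set (n.+1 + 0)%N] = \bigcup_n C n.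
  by apply: eq_bigcupr => k _; rewrite /C /surviving_jump addn0.
rewrite oppr0; apply: le_trans.
rewrite (eq_eseriesr (fun k _ => mu_surviving_jump k.+1 [set k.+1])).
rewrite rho_series//.
rewrite -[leRHS]mule1; apply: lee_wpmul2l; first exact: measure_ge0.
rewrite (eq_eseriesr (g := fun n => nu [set (n + 1)%N])).
  exact: sum_singletons.
by move=> k _; rewrite addn1.
Qed.

(** Turns m and n into children of 0. *)
Definition overwrite (m n : nat) (x : nat -> nat) : nat -> nat :=
  fun i => if (i == m) || (i == n) then i else x i.

(** The descendants of m are unaffected because n, being the child of a root,
    is not one of them. *)
Lemma surviving_crossing_overwrite (m n : nat) (x : nat -> nat) : (m < n)%N ->
  surviving_jump m [set k | (m <= k)%N] x ->
  surviving_jump n [set k | (n <= k)%N] x ->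
  surviving m (overwrite m n x) /\ surviving n (overwrite m n x).
Proof.
move=> mn [sm /= xm] [sn /= xn].
split=> N.
  have [t Nt mt] := sm N; exists t => //; apply: ancestor_congr mt => j mj jt maj.
  rewrite /overwrite; case: ifPn => // /orP[/eqP jm|/eqP jn]; first by lia.
  move: maj; rewrite jn => /ancestor_neq => /(_ ltac:(by apply/eqP; lia)).
  by move=> /ancestor_le; rewrite parent_pos//; lia.
have [t Nt nt] := sn N; exists t => //; apply: ancestor_congr nt => j nj jt naj.
by rewrite /overwrite; case: ifPn => // /orP[/eqP jm|/eqP jn]; lia.
Qed.

(** The event H that m and n survive after overwriting their steps does not
    depend on these steps. Together with the values m and n for these steps it
    makes m and n surviving siblings, which has probability 0; as these values
    have positive probability, H has probability 0. *)
Lemma surviving_crossings : (forall n, (0 < n)%N -> 0 < nu [set n]) ->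
  forall m n : nat, (0 < m)%N -> (m < n)%N ->
  mu (surviving_jump m [set k | (m <= k)%N] `&`
      surviving_jump n [set k | (n <= k)%N]) = 0.
Proof.
move=> q0 m n m0 mn.
pose H := overwrite m n @^-1` (surviving m `&` surviving n).
pose J := [set i | i != m /\ i != n].
have sH : sigma J H.
  apply: (sigma_preimage setT J (overwrite m n)); last first.
    by apply: sigma_setI; exact: surviving_measurable.
  move=> i B _; rewrite /overwrite.
  case: (boolP ((i == m) || (i == n))) => [_|]; first exact: sigma_const.
  by rewrite negb_or => /andP[im in_]; apply: sigma_coord.
have mH : sigma setT H by exact: sigma_measurable sH.
have jump k : sigma [set k] [set x : nat -> nat | x k = k].
  exact: (sigma_coord [set k] k [set k]).
have mjump k : sigma setT [set x : nat -> nat | x k = k].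
  exact: (sigma_coord setT k [set k]).
have H0 : mu H = 0.
  have : mu (H `&` ([set x | x m = m] `&` [set x | x n = n])) = 0.
    rewrite -(surviving_siblings m n m0 mn); congr (mu _).
    apply/seteqP; split=> x [].
      rewrite /H /= => -[sm sn] [xm xn].
      have xx : overwrite m n x = x.
        by apply/funext => i; rewrite /overwrite; case: ifPn => // /orP[]/eqP ->.
      by rewrite xx in sm sn.
    move=> [sm /= xm] [sn /= xn]; split=> //; rewrite /H /=.
    have -> : overwrite m n x = x.
      by apply/funext => i; rewrite /overwrite; case: ifPn => // /orP[]/eqP ->.
    by [].
  rewrite (indep mu iid J [set m; n] H)//; last 2 first.
  - by move=> i [/eqP im /eqP in_] [].
  - by apply: sigma_setI; [apply: sigma_sub (jump m)|apply: sigma_sub (jump n)]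
      => i ->; [left|right].
  rewrite (indep mu iid [set m] [set n])//; last by move=> i /= -> ?; lia.
  rewrite (mu_coord mu iid m [set m]) (mu_coord mu iid n [set n]).
  have qm := q0 m m0; have qn := q0 n (ltn_trans m0 mn).
  by move/eqP; rewrite !mule_eq0 !(gt_eqF qm) !(gt_eqF qn) !orbF => /eqP.
apply/eqP; rewrite eq_le measure_ge0 andbT -H0; apply: le_measure; rewrite ?inE//.
  by apply: sigma_setI; exact: surviving_jump_measurable.
by move=> x [sm sn]; exact: surviving_crossing_overwrite.
Qed.

(** The expected number of surviving vertices with a root as parent, when there
    is almost surely at most one. *)
Lemma crossing_sum : (forall m n : nat, (0 < m)%N -> (m < n)%N ->
  mu (surviving_jump m [set k | (m <= k)%N] `&`
      surviving_jump n [set k | (n <= k)%N]) = 0) ->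
  rho * \sum_(n <oo) nu [set k | (n < k)%N] =
  mu (\bigcup_n surviving_jump n.+1 [set k | (n < k)%N]).
Proof.
move=> null; pose F n := surviving_jump n.+1 [set k | (n < k)%N].
have mF k : measurable (F k : set seqspace) by exact: surviving_jump_measurable.
rewrite -(measure_almost_disjoint _ _ _ mu F mF); last by move=> m n mn; exact: null.
rewrite (eq_eseriesr (fun k _ => mu_surviving_jump k.+1 [set l | (k < l)%N])).
by rewrite rho_series.
Qed.

(** Here rho * oo is a probability, so rho = 0 and no vertex n >= 0 survives;
    a surviving root would have a surviving child. *)
Lemma infinite_mean_extinction : (forall n, (0 < n)%N -> 0 < nu [set n]) ->
  \sum_(n <oo) nu [set k | (n < k)%N] = +oo ->
  forall i : int, (i <= 0)%R -> mu (surviving i) = 0.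
Proof.
move=> q0 infmean i i0.
have rho0 : rho = 0.
  have := crossing_sum (surviving_crossings q0); rewrite infmean => rhoE.
  apply/eqP; rewrite eq_le measure_ge0 andbT leNgt; apply/negP => rho_gt0.
  have : mu (\bigcup_n surviving_jump n.+1 [set k | (n < k)%N]) <= 1.
    apply: probability_le1; apply: sigma_bigcup => n; exact: surviving_jump_measurable.
  by rewrite -rhoE gt0_muley.
have -> : i = (- `|i|%N%:Z)%R by lia.
apply/eqP; rewrite eq_le measure_ge0 andbT.
apply: le_trans (surviving_has_surviving_child _) _.
have mS n : measurable (surviving_jump n.+1 [set (n.+1 + `|i|)%N] : set seqspace).
  exact: surviving_jump_measurable.
apply: le_trans (measure_sigma_subadditive mu mS
  (bigcupT_measurable _ mS) (@subset_refl _ _)) _.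
rewrite eseries0// => n _ _; apply: etrans (mu_surviving_jump _ _) _.
by rewrite rho0 mul0e.
Qed.

End renewal.

(** * Finite mean: a cofinal trunk *)

Section regeneration.
Local Open Scope ereal_scope.
Context {R : realType}.
Variable mu : probability seqspace R.
Let nu (B : set nat) := mu [set x | B (x 0%N)].
Hypothesis iid : forall s B, uniq s -> mu (cylinder s B) = \prod_(i <- s) nu (B i).
Hypothesis nu0 : nu [set 0%N] = 0.
Hypothesis aper : aperiodic (fun n => nu [set n]).
Hypothesis mean_fin : \sum_(n <oo) nu [set k | (n < k)%N] < +oo.

Let mu_coord_measurable n (B : set nat) :
  measurable ([set x | B (x n)] : set seqspace).
Proof. exact: (sigma_coord setT n B I). Qed.

Lemma tail_sum_small : exists W, \sum_(W <= n <oo) nu [set k | (n < k)%N] < 1.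
Proof.
apply: contrapT => /forallNP big.
have tail0 := nneseries_tail_cvg mean_fin (fun k _ => measure_ge0 mu _).
have : 1 <= (0 : \bar R).
  rewrite -(cvg_lim _ tail0)//; apply: lime_ge.
    by apply/cvg_ex; exists 0; exact: tail0.
  by apply: nearW => n; rewrite leNgt; apply/negP; exact: big.
by rewrite lee_fin ler10.
Qed.

Lemma funnel_event_shift Q step N W c :
  funnel_event Q step N W c = shift c @^-1` funnel_event Q step N W 0.
Proof.
by apply/seteqP; split=> x fx k k0; have := fx k k0; rewrite /shift add0n addnC.
Qed.

Lemma sigma_funnel_event Q step N W c :
  sigma [set i | (c < i)%N] (funnel_event Q step N W c).
Proof.
have -> : funnel_event Q step N W c = \bigcap_(k in [set k | (0 < k)%N])
    [set x | funnel Q step N W k (x (c + k)%N)] by [].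
by apply: sigma_bigcap => k /= k0; apply: sigma_coord => /=; lia.
Qed.

(** The event splits into independent parts: finitely many conditions of
    positive probability, and infinitely many whose complements have total
    probability less than 1 by the choice of W. *)
Lemma funnel_event_gt0 Q step N W :
  (forall s, Q s -> 0 < nu [set s]) ->
  (forall k, (0 < k)%N -> generated Q k -> Q (step k)) ->
  \sum_(W <= n <oo) nu [set k | (n < k)%N] < 1 ->
  0 < mu (funnel_event Q step N W 0).
Proof.
move=> Qnu stepQ tail1; pose B := funnel Q step N W.
pose A1 := cylinder (iota 1 (N + W)) B.
pose A2 := \bigcap_j [set x : nat -> nat | B (N + W + j).+1 (x (N + W + j).+1)].
have -> : funnel_event Q step N W 0 = A1 `&` A2.
  apply/seteqP; split=> [x fx|x [x1 x2] k k0].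
    split=> [i|j _ /=]; last by have := fx (N + W + j).+1 isT; rewrite add0n.
    by rewrite mem_iota => /andP[i0 _]; have := fx i i0; rewrite add0n.
  rewrite add0n; have [kW|Wk] := leqP k (N + W).
    by apply: x1; rewrite mem_iota; lia.
  have := x2 (k - (N + W).+1)%N I; rewrite /=.
  by have -> : (N + W + (k - (N + W).+1)).+1 = k by lia.
have sA1 : sigma [set i | (i <= N + W)%N] A1.
  apply: sub_sigma_algebra; exists (iota 1 (N + W)), B; split=> // i.
  by rewrite mem_iota /=; lia.
have sA2 : sigma [set i | (N + W < i)%N] A2.
  by apply: sigma_bigcap => j _; apply: sigma_coord => /=; lia.
have mA2 : measurable (A2 : set seqspace) by exact: sigma_measurable sA2.
rewrite (indep mu iid _ _ _ _ _ sA1 sA2); last by move=> i /= ? ?; lia.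
apply: mule_gt0.
  rewrite iid ?iota_uniq// big_seq.
  elim/big_ind: _ => [|a b a0 b0|i]; [exact: lte01|exact: mule_gt0|].
  rewrite mem_iota => iN.
  have [gi|ngi] := pselect (generated Q i); last first.
    have -> : B i = setT.
      by apply/seteqP; split=> // z _; rewrite /B /funnel ifT /=; [|lia].
    by rewrite /nu [X in mu X](_ : _ = setT)// probability_setT lte01.
  apply: lt_le_trans (Qnu _ (stepQ i ltac:(lia) gi)) _.
  apply: le_measure; rewrite ?inE; [exact: mu_coord_measurable..|].
  by move=> x /= ->; rewrite /B /funnel ifT /=; [|lia].
have mC j : measurable
    (~` [set x : nat -> nat | B (N + W + j).+1 (x (N + W + j).+1)] : set seqspace).
  by apply: measurableC; exact: mu_coord_measurable.
have CA2 : mu (~` A2) < 1.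
  apply: le_lt_trans tail1; rewrite setC_bigcap.
  apply: le_trans (measure_sigma_subadditive mu mC
    (bigcupT_measurable _ mC) (@subset_refl _ _)) _.
  rewrite -[leRHS](@nneseries_addn _ (fun n => nu [set k | (n < k)%N]) W)//.
  apply: lee_nneseries => // j _.
  rewrite [leLHS](_ : _ = nu (~` B (N + W + j).+1)); last first.
    by rewrite -[RHS](mu_coord mu iid (N + W + j).+1).
  apply: (@le_trans _ _ (mu ([set x | (j + W < x 0)%N] `|` [set x | x 0%N = 0%N]))).
    apply: le_measure; rewrite ?inE; [exact: mu_coord_measurable| |].
      apply: measurableU; last exact: (mu_coord_measurable 0 [set 0%N]).
      exact: (mu_coord_measurable 0 [set k | (j + W < k)%N]).
    move=> x; rewrite /B /funnel ifF /=; last by lia.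
    move=> nx; case: (posnP (x 0%N)) => x0; [by right|left].
    by rewrite /= ltnNge; apply/negP => xW; apply: nx; lia.
  rewrite (@measureU0 _ seqspace _ mu)//.
  - exact: (mu_coord_measurable 0 [set k | (j + W < k)%N]).
  - exact: (mu_coord_measurable 0 [set 0%N]).
move: CA2; rewrite probability_setC// lteBlDr//; last by exact: (fin_num_measure mu).
by rewrite -[X in X < _]adde0 lteD2lE.
Qed.

(** The limsup of the funnel events has probability at least that of one of
    them, which is positive, and it is a tail event. *)
Lemma trunk_cofinal_as : exists A : set (nat -> nat),
  [/\ sigma setT A, mu A = 1 &
   forall x, A x -> (forall n, (0 < x n)%N) -> trunk_cofinal x].
Proof.
(* the support of the step distribution *)
pose Q := [set s | 0 < nu [set s]].
have Qpos s : Q s -> (0 < s)%N.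
  by move=> Qs; rewrite lt0n; apply/eqP => s0; move: Qs; rewrite /Q/= s0 nu0 ltxx.
have Qgcd m : (forall s, Q s -> (m %| s)%N) -> m = 1%N.
  by move=> Qm; apply: aper => n _; exact: Qm.
have [N cofin] := generated_cofinite Q Qpos Qgcd.
have /choice[step stepP] k : exists s, (0 < k)%N -> generated Q k ->
    [/\ Q s, (s <= k)%N & generated Q (k - s)].
  have [[k0 gk]|h] := pselect ((0 < k)%N /\ generated Q k); last first.
    by exists 0%N => k0 gk; case: h.
  by have [s h] := generated_step Q k k0 gk; exists s.
have [W tail1] := tail_sum_small.
pose G := funnel_event Q step N W.
have mG c : measurable (G c : set seqspace).
  exact: sigma_measurable (sigma_funnel_event _ _ _ _ c).
have sG c : sigma [set i | (c < i)%N] (G c) by exact: sigma_funnel_event.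
exists (lim_sup_set G); split.
- by apply: sigma_bigcap => n _; apply: (@bigcup_measurable _ seqspace) => j _; exact: mG.
- apply: (kolmogorov01 mu iid) => [M|].
    have -> : lim_sup_set G = \bigcap_n \bigcup_(j in [set j | (n + M <= j)%N]) G j.
      apply/seteqP; split=> x Gx n _; first exact: (Gx (n + M)%N I).
      by have [j /= nj Gj] := Gx n I; exists j => //=; lia.
    apply: sigma_bigcap => n _.
    apply: (@bigcup_measurable _
      (g_sigma_algebraType (cylinders [set i | (M <= i)%N]))) => j /= nj.
    by apply: sigma_sub (sG j) => i /=; lia.
  have G0 : 0 < mu (G 0%N).
    by apply: funnel_event_gt0 => // k k0 gk; have [] := stepP k k0 gk.
  apply: (lt_le_trans G0).
  have fin : mu (\bigcup_(k >= 0) G k) < +oo.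
    rewrite (le_lt_trans (probability_le1 _ _)) ?ltry//.
    by apply: bigcup_measurable => j _; exact: mG.
  have cv := lim_sup_set_cvg mu G mG fin.
  rewrite -(cvg_lim _ cv)//; apply: lime_ge.
    by apply/cvg_ex; exists (mu (lim_sup_set G)); exact: cv.
  apply: nearW => n.
  have -> : mu (G 0%N) = mu (G n).
    rewrite /G (funnel_event_shift _ _ _ _ n) mu_shift//; exact: mG.
  apply: le_measure; rewrite ?inE//; first by apply: bigcup_measurable => j _; exact: mG.
  by move=> x Gx; exists n => /=.
- move=> x Gx x0 M; have [c Mc Gc] := Gx M I; exists c => //.
  exact: funnel_trunk Qpos stepP cofin _ _ Gc.
Qed.

(** Along a cofinal trunk the surviving vertices are the trunk vertices, and
    exactly one of those has a root as parent. *)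
Lemma finite_mean_survival :
  mu (surviving 0) * \sum_(n <oo) nu [set k | (n < k)%N] = 1.
Proof.
have [A [mA A1 Atrunk]] := trunk_cofinal_as.
pose pos := \bigcap_n [set x : nat -> nat | (0 < x n)%N].
have mpos : sigma setT pos.
  by apply: sigma_bigcap => n _; exact: (sigma_coord setT n [set k | (0 < k)%N]).
have pos0 : mu (~` pos) = 0.
  apply/eqP; rewrite eq_le measure_ge0 andbT setC_bigcap.
  have mC n : measurable (~` [set x : nat -> nat | (0 < x n)%N] : set seqspace).
    by apply: measurableC; exact: (mu_coord_measurable n [set k | (0 < k)%N]).
  apply: le_trans (measure_sigma_subadditive mu mC
    (bigcupT_measurable _ mC) (@subset_refl _ _)) _.
  rewrite eseries0// => n _ _; rewrite -[RHS]nu0 -[RHS](mu_coord mu iid n [set 0%N]).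
  by congr (mu _); apply/seteqP; split=> x /=; [move/negP; lia|move=> ->].
have A0 : mu (~` A) = 0 by rewrite probability_setC// A1 subee.
have mE : measurable ((~` A `|` ~` pos) : set seqspace).
  by apply: measurableU; apply: measurableC.
have E0 : mu (~` A `|` ~` pos) = 0.
  by rewrite (@measureU0 _ seqspace _ mu) => //; apply: measurableC.
have good x : ~ (~` A `|` ~` pos) x -> (forall n, (0 < x n)%N) /\ trunk_cofinal x.
  move=> /not_orP[/contrapT Ax /contrapT px].
  by have x0 n : (0 < x n)%N by [exact: px n I]; split=> //; exact: Atrunk.
pose F n := surviving_jump n [set k | (n <= k)%N].
have crossP x : (forall n, (0 < x n)%N) -> trunk_cofinal x -> forall n, (0 < n)%N ->
    F n x <-> trunk_nat x n /\ (parent x n <= 0)%R.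
  move=> x0 tx n n0; rewrite /F /surviving_jump /surviving /= parent_pos//.
  split=> [[sn xn]|[[_ tn] xn]]; split; try lia.
    by split=> //; exact: infinite_offspring_trunk.
  exact: trunk_infinite.
rewrite (crossing_sum mu iid) => [|m n m0 mn].
  apply/eqP; rewrite eq_le probability_le1/=; last first.
    by apply: sigma_bigcup => n; exact: surviving_jump_measurable.
  have CE : mu (~` (~` A `|` ~` pos)) = 1 by rewrite probability_setC// E0 sube0.
  rewrite -CE; apply: le_measure; rewrite ?inE.
  - exact: measurableC.
  - by apply: sigma_bigcup => n; exact: surviving_jump_measurable.
  - move=> x /good[x0 tx]; have [n [tn pn _]] := trunk_first x x0 tx.
    have n0 : (0 < n)%N by case: tn.
    by exists n.-1 => //; rewrite prednK//; apply/crossP.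
apply/eqP; rewrite eq_le measure_ge0 andbT -E0; apply: le_measure; rewrite ?inE//.
  by apply: sigma_setI; exact: surviving_jump_measurable.
move=> x [Fm Fn]; apply: contrapT => /good[x0 tx].
have n0 : (0 < n)%N by exact: leq_ltn_trans mn.
have [tm pm] := (crossP x x0 tx m m0).1 Fm.
have [tn pn] := (crossP x x0 tx n n0).1 Fn.
have [k [_ _ uniq]] := trunk_first x x0 tx.
by move: mn; rewrite (uniq m tm pm) (uniq n tn pn) ltnn.
Qed.

End regeneration.

Section law_of_steps.
Local Open Scope ereal_scope.
Context d (T : measurableType d) (R : realType) (P : probability T R).
Variable Z : nat -> {RV P >-> nat}.
Hypothesis Zindep : mutually_independent Z.
Hypothesis Zid : identically_distributed Z.

Definition path_of (w : T) : seqspace := Z ^~ w.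

Lemma measurable_path_of : measurable_fun setT path_of.
Proof.
apply: (@measurability _ _ T seqspace setT path_of (cylinders setT)) => //.
move=> _ [_ [s [B [_ ->]]] <-]; rewrite setTI.
have -> : path_of @^-1` cylinder s B = \bigcap_(i in [set` s]) (Z i @^-1` B i).
  by apply/seteqP; split.
apply: bigcap_measurableType => i _; rewrite -[X in measurable X]setTI.
exact: (measurable_funPT (Z i)).
Qed.

HB.instance Definition _ := isMeasurableFun.Build _ _ _ _ path_of measurable_path_of.

Definition law : probability seqspace R := distribution P path_of.

Lemma lawE E : law E = P (path_of @^-1` E).
Proof. by []. Qed.

Lemma law_iid s B : uniq s ->
  law (cylinder s B) = \prod_(i <- s) law [set x | B i (x 0%N)].
Proof.
move=> us; rewrite lawE.
have -> : path_of @^-1` cylinder s B = \bigcap_(i in [set` s]) (Z i @^-1` B i).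
  by apply/seteqP; split.
rewrite Zindep//; apply: eq_bigr => i _; exact: Zid.
Qed.

End law_of_steps.
Arguments path_of {d T R} P Z.
Arguments measurable_path_of {d T R} P Z.
Arguments law {d T R} P Z.
Arguments lawE {d T R} P Z.
Arguments law_iid {d T R} P Z.

(** * Transfer to the random forest *)

Lemma trunk_cofinal_forest (R : realType) (z : nat -> nat) :
  (forall n, (0 < z n)%N) -> trunk_cofinal z ->
  (exists! i : int, i <= 0 /\ tree_size R z i = +oo%E) /\
  (exists! A : set nat, maximal_infinite_path z A).
Proof.
move=> z0 tz; split.
  have [i [[i0 ti] iu]] := trunk_root z z0 tz; exists i; split.
    by split=> //; apply/tree_size_infty => //; exact: trunk_infinite.
  move=> j [j0 /tree_size_infty -/(_ z0 j0) jinf]; apply: iu; split=> //.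
  exact: infinite_offspring_trunk.
exists (trunk_nat z); split; first exact: trunk_is_path.
by move=> A /maximal_infinite_path_trunk -> .
Qed.

Local Open Scope ereal_scope.

Theorem theorem3 (d : measure_display) (T : measurableType d) (R : realType)
  (P : probability T R) (Z : nat -> {RV P >-> nat})
  (Zpos : forall (n : nat) (w : T), (0 < Z n w)%N)
  (Zindep : mutually_independent Z)
  (Zid : identically_distributed Z) :
  let q := fun n : nat => P [set w | Z 0%N w = n] in
  let EZ := 'E_P[fun w => (Z 0%N w)%:R] in
  let S := fun (i : int) (w : T) => tree_size R (Z ^~ w) i in
  (aperiodic q -> EZ < +oo ->
     {ae P, forall w,
        (exists! i : int, (i <= 0)%R /\ S i w = +oo) /\
        (exists! A : set nat, maximal_infinite_path (Z ^~ w) A)} /\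
     P [set w | S 0%R w = +oo] = 1 / EZ) /\
  ((forall n : nat, (0 < n)%N -> 0 < q n) -> EZ = +oo ->
     P [set w | exists i : int, (i <= 0)%R /\ S i w = +oo] = 0).
Proof.
move=> q EZ S.
have iid := law_iid P Z Zindep Zid.
have EZE : EZ = \sum_(n <oo) law P Z [set x | (n < x 0%N)%N].
  exact: expectation_tail_sum.
have SE i : (i <= 0)%R -> [set w | S i w = +oo] = path_of P Z @^-1` surviving i.
  move=> i0; have h w := tree_size_infty R (Z ^~ w) i (Zpos ^~ w) i0.
  by apply/seteqP; split=> w; [exact: (h w).1|exact: (h w).2].
split=> [aper EZfin|qpos EZinf].
- have q0 : law P Z [set x | x 0%N = 0%N] = 0.
    rewrite lawE [X in P X](_ : _ = set0) ?measure0//.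
    apply/seteqP; split=> // w /= Zw.
    by have := Zpos 0%N w; rewrite -[Z 0%N w]/(path_of P Z w 0%N) Zw.
  have EZfin' := EZfin; rewrite EZE in EZfin'.
  split.
    have [A [mA A1 Atrunk]] := trunk_cofinal_as (law P Z) iid q0 aper EZfin'.
    exists (~` (path_of P Z @^-1` A)); split.
    + apply: measurableC; rewrite -[X in measurable X]setTI.
      exact: (measurable_path_of P Z).
    + rewrite probability_setC.
        by rewrite -[P _](lawE P Z) A1 subee.
      rewrite -[X in measurable X]setTI; exact: (measurable_path_of P Z).
    + move=> w /= nw Aw; apply: nw; apply: trunk_cofinal_forest => //.
      exact: Atrunk.
  rewrite SE// -lawE.
  have := finite_mean_survival (law P Z) iid q0 aper EZfin'.
  rewrite -EZE; have : (0 <= EZ) by rewrite EZE; apply: nneseries_ge0.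
  case: EZ EZfin {EZE EZfin'} => [r _ r0|//|//].
  have : law P Z (surviving 0) \is a fin_num.
    by apply: fin_num_measure; exact: surviving_measurable.
  case: (law P Z _) => // s _ [] sr.
  have rn0 : r != 0%R.
    apply/eqP => r00; move: sr; rewrite r00 mulr0 => /eqP.
    by rewrite eq_sym oner_eq0.
  by rewrite inver (negbTE rn0) -EFinM -sr mulfK.
- have ext i : (i <= 0)%R -> law P Z (surviving i) = 0.
    by apply: (infinite_mean_extinction _ iid) => //; rewrite -EZE.
  have -> : [set w | exists i : int, (i <= 0)%R /\ S i w = +oo] =
      path_of P Z @^-1` (\bigcup_n surviving (- n%:Z)%R).
    apply/seteqP; split=> w /=.
      move=> [i [i0 Si]]; exists `|i|%N => //.
      have -> : (- `|i|%N%:Z)%R = i by lia.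
      by have : [set w | S i w = +oo] w by []; rewrite SE.
    move=> [n _ sn]; exists (- n%:Z)%R; split; first by lia.
    by suff : [set w | S (- n%:Z)%R w = +oo] w by []; rewrite SE//; lia.
  rewrite -lawE; apply/eqP; rewrite eq_le measure_ge0 andbT.
  have mS n : measurable (surviving (- n%:Z)%R : set seqspace).
    exact: surviving_measurable.
  apply: le_trans (measure_sigma_subadditive _ mS
    (bigcupT_measurable _ mS) (@subset_refl _ _)) _.
  by rewrite eseries0// => n _ _; apply: ext; lia.
Qed.
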